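(* For every countable ordinal $\alpha\geq 2$, there is no $\mathbf{\Sigma}^0_\alpha$-complete subset of $\mathbb{R}$ and no $\mathbf{\Pi}^0_\alpha$-complete subset of $\mathbb{R}$. In fact, there is a collection $\langle B_a\mid a\subseteq\omega\rangle$ of $D_2(\mathbf{\Sigma}^0_1)$-subsets of $\mathbb{R}$ such that for every subset $B$ of $\mathbb{R}$, $B_a\leq B$ holds for only countably many sets $a\subseteq\omega$. Moreover, the same statement holds for $\check{D}_2(\mathbf{\Sigma}^0_1)$-sets: there is a collection $\langle B'_a\mid a\subseteq\omega\rangle$ of $\check{D}_2(\mathbf{\Sigma}^0_1)$-subsets of $\mathbb{R}$ such that for every subset $B$ of $\mathbb{R}$, $B'_a\leq B$ holds for only countably many sets $a\subseteq\omega$.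
   Context: For subsets $A,B$ of $\mathbb{R}$, $A\leq B$ ($A$ is reducible to $B$) means that there is a continuous function $f\colon\mathbb{R}\to\mathbb{R}$ with $A=f^{-1}(B)$. For a collection $\mathcal{C}$ of subsets of $\mathbb{R}$, a set $A\in\mathcal{C}$ is complete for $\mathcal{C}$ ($\mathcal{C}$-complete) if $B\leq A$ for all $B\in\mathcal{C}$. A subset of $\mathbb{R}$ is $D_2(\mathbf{\Sigma}^0_1)$ if it is the intersection of an open and a closed set, and $\check{D}_2(\mathbf{\Sigma}^0_1)$ if its complement is $D_2(\mathbf{\Sigma}^0_1)$. $\mathbf{\Sigma}^0_\alpha$ and $\mathbf{\Pi}^0_\alpha$ denote the usual levels of the Borel hierarchy on $\mathbb{R}$. *)

(* Defs.v *)
From mathcomp Require Import all_boot all_order all_algebra.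
From mathcomp Require Import all_classical all_reals all_analysis.

Set Implicit Arguments.
Unset Strict Implicit.
Unset Printing Implicit Defensive.

Import Order.TTheory GRing.Theory Num.Theory.
Import numFieldNormedType.Exports.

Local Open Scope classical_set_scope.

(* An ordinal is given as an element x of a well-founded total order W: x
   stands for the order type of its set of predecessors [set y | y < x].
   Thus the least element of W stands for 0, and every ordinal arises this way.
   Countable means finite or countably infinite. *)
Definition countable_ordinal d (W : orderType d) (x : W) : Prop :=
  well_founded (fun y z : W => (y < z)%O) /\ countable [set y : W | (y < x)%O].

Definition ord_one d (W : orderType d) (x : W) : Prop :=
  exists y : W, [set z : W | (z < x)%O] = [set y].

Definition ord_ge2 d (W : orderType d) (x : W) : Prop :=
  exists y z : W, (y < z)%O /\ (z < x)%O.

(* The levels start at 1: no set is Sigma0 at the ordinal 0, so the ordinals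
   y n in Sigma0_bigcup range over 1 <= y n < x. The sets B n there are
   Pi0 at y n. *)
Inductive Sigma0 (R : realType) d (W : orderType d) : W -> set R -> Prop :=
| Sigma0_open (x : W) (A : set R) : ord_one x -> open A -> Sigma0 x A
| Sigma0_bigcup (x : W) (y : nat -> W) (B : nat -> set R) :
    ord_ge2 x -> (forall n, (y n < x)%O) ->
    (forall n, Sigma0 (y n) (~` B n)) ->
    Sigma0 x (\bigcup_n B n).

Definition Pi0 (R : realType) d (W : orderType d) (x : W) (A : set R) : Prop :=
  Sigma0 x (~` A).

Definition reducible (R : realType) (A B : set R) : Prop :=
  exists f : R -> R, continuous f /\ A = f @^-1` B.

Definition complete_for (R : realType) (C : set (set R)) (A : set R) : Prop :=
  C A /\ forall B : set R, C B -> reducible B A.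

Definition D2 (R : realType) (A : set R) : Prop :=
  exists U F : set R, [/\ open U, closed F & A = U `&` F].

Definition dual_D2 (R : realType) (A : set R) : Prop := D2 (~` A).

(* Main.v *)
Require Import Defs.
From mathcomp Require Import all_boot all_order all_algebra.
From mathcomp Require Import all_classical all_reals all_analysis.
From mathcomp Require Import lra zify.

(* The set coded by D contains the interiors of the gaps [k, k+1] with k even,
   misses those with k odd, and contains some of the endpoints 1, 2, ...: the
   endpoints k and k+1 have the same status exactly when k is in D. Below 0 it
   consists of isolated points accumulating at 0, which is not in the set.

   Let a continuous f reduce it to B. Each f k is a boundary point of B and by
   the intermediate value theorem B is constant between f k and f (k+1), with
   a value alternating with k; so consecutive images are equal or adjacent
   boundary points, and they differ when k is not in D. The walk k |-> f k can
   therefore reverse direction only at a gap in D. When no element of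
   ]k, 2k+1] is in D for k in D, a reversal at k forces the walk to retrace
   all its steps back to f 0 and to go past it, which is impossible because the
   isolated points make B nonconstant just behind f 0. So the walk is monotone,
   B and f 0 determine it, and B then determines which endpoints are in the
   set, that is D. Finally f 0 is the left (or right) end of a nonempty open
   interval contained in B, so it takes only countably many values. Sparse sets
   D are obtained as {4^i | i in a}.

   The sets constructed are F_sigma with F_sigma complement, hence they lie in
   every class Sigma_alpha and Pi_alpha with alpha >= 2, whereas a complete set
   would have continuum many of them below it. *)

Set Implicit Arguments.
Unset Strict Implicit.
Unset Printing Implicit Defensive.

Import Order.TTheory GRing.Theory Num.Theory.
Import numFieldNormedType.Exports.

Local Open Scope classical_set_scope.
Local Open Scope ring_scope.

(** * Walks along the boundary points of a set *)

Section Walk.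
Context (R : realType) (B : set R).

(** Vacuous when [r <= l], so that constancy can be required of a step of a walk in both directions
    without knowing which way it goes. *)
Definition const_on (c : bool) (l r : R) := forall u, l < u < r -> (B u <-> c).

Definition bdry (z : R) := forall l r c, l < z < r -> ~ const_on c l r.

Lemma const_on_sub {c l r l' r'} : l <= l' -> r' <= r ->
  const_on c l r -> const_on c l' r'.
Proof. by move=> ll' rr' h u /andP[? ?]; apply: h; lra. Qed.

Lemma const_on_inj {c c' l r} : l < r ->
  const_on c l r -> const_on c' l r -> c = c'.
Proof.
move=> lr h h'.
have mid : l < (l + r) / 2 < r by lra.
have [h1 h2] := h _ mid; have [h3 h4] := h' _ mid.
by apply/idP/idP; tauto.
Qed.

(** If the ends differed, the nearer one would be a boundary point inside an interval of constancy.
    The values then agree on the common interval. *)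
Lemma adjacentR {c c' z e e'} : bdry e -> bdry e' -> z < e -> z < e' ->
  const_on c z e -> const_on c' z e' -> e = e' /\ c = c'.
Proof.
move=> be be' ze ze' h h'; split.
  case: (ltgtP e e') => // ee'.
    by case: (be z e' c') => //; rewrite ze.
  by case: (be' z e c) => //; rewrite ze'.
have zm : z < Num.min e e' by rewrite lt_min ze.
by apply: (const_on_inj zm); [apply: const_on_sub h | apply: const_on_sub h'];
  rewrite ?ge_min ?lexx ?orbT.
Qed.

Lemma adjacentL {c c' z e e'} : bdry e -> bdry e' -> e < z -> e' < z ->
  const_on c e z -> const_on c' e' z -> e = e' /\ c = c'.
Proof.
move=> be be' ez ez' h h'; split.
  case: (ltgtP e e') => // ee'.
    by case: (be' e z c) => //; rewrite ee'.
  by case: (be e' z c') => //; rewrite ee'.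
have zm : Num.max e e' < z by rewrite gt_max ez.
by apply: (const_on_inj zm); [apply: const_on_sub h | apply: const_on_sub h'];
  rewrite ?le_max ?lexx ?orbT.
Qed.

(* The properties of z k = f k for a reduction f to B with f 0 < f 1. *)
Record walk (D : pred nat) (z : nat -> R) : Prop := Walk {
  walk_bdry : forall k, bdry (z k);
  walk_up : forall k, const_on (~~ odd k) (z k) (z k.+1);
  walk_down : forall k, const_on (~~ odd k) (z k.+1) (z k);
  walk_neq : forall k, ~~ D k -> z k != z k.+1;
  walk_right : z 0 < z 1;
  walk_anchor : forall l c, l < z 0 -> ~ const_on c l (z 0) }.

Arguments walk_bdry [D z] w k _ _ _ _ _ : rename.
Arguments walk_up [D z] w k [u] _ : rename.
Arguments walk_down [D z] w k [u] _ : rename.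

(** The window after [k] has [k+1] gaps: [k] to walk from [z k = z k.+1] back to [z 0], and one more
    to go past it. *)
Definition sparse (D : pred nat) :=
  forall k j, D k -> (k.+1 <= j <= k.*2.+1)%N -> ~~ D j.

Section Monotone.
Context {D : pred nat} (D_sparse : sparse D) (D0 : ~~ D 0).

(** Gaps [k] and [k+1] would both map onto the interval just left of [z k.+1], although their
    parities differ. *)
Lemma walk_straight z k : walk D z -> z k < z k.+1 -> z k.+2 < z k.+1 -> False.
Proof.
move=> w up down.
have [_ /esym] := adjacentL (walk_bdry w k) (walk_bdry w _) up down
  (walk_up w k) (walk_down w _).
by rewrite /=; case: odd.
Qed.

Lemma walk_no_fold z k : walk D z -> (forall j, (j <= k)%N -> z j <= z j.+1) ->
  z k.+2 < z k.+1 -> False.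
Proof.
move=> w mono down.
have zk : z k = z k.+1.
  apply/eqP; case: ltgtP (mono k (leqnn k)) => // up _.
  by case: (walk_straight w up down).
have Dk : D k by apply: contraT => /(walk_neq w); rewrite zk eqxx.
(* The gaps k+1, ..., 2k+1 are not in D, so the walk keeps going down. *)
have fall i : (i <= k)%N -> z (k + i).+2 < z (k + i).+1.
  elim: i => [|i IH] ik; first by rewrite addn0.
  have {}IH := IH (ltnW ik); rewrite addnS.
  have : z (k + i).+2 != z (k + i).+3.
    by apply: (walk_neq w); apply: (D_sparse Dk) => //; lia.
  case: ltgtP => // up _; exfalso.
  have [_] := adjacentR (walk_bdry w _) (walk_bdry w _) IH up
    (walk_down w _) (walk_up w _).
  by rewrite /=; case: odd.
have retrace i : (i <= k)%N -> z (k + i).+1 = z (k - i)%N.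
  elim: i => [|i IH] ik; first by rewrite addn0 subn0.
  have {}IH := IH (ltnW ik); have f := fall _ (ltnW ik).
  set m := (k - i.+1)%N; have km : (k - i)%N = m.+1 by rewrite /m; lia.
  have par : odd (k + i).+1 = odd m by rewrite /m; lia.
  rewrite addnS; rewrite km in IH.
  have hf := walk_down w (k + i).+1; rewrite par IH in hf; rewrite IH in f.
  have : z m <= z m.+1 by apply: mono; rewrite /m; lia.
  rewrite le_eqVlt => /orP[/eqP zm|up]; last first.
    by have [] := adjacentL (walk_bdry w _) (walk_bdry w _) f up hf
      (walk_up w _).
  (* A stalled gap [m] is in [D], so by sparsity the gap before it is not and leads strictly up to
     [z m]; its parity is opposite to that of the descending gap, yet both lie just left of
     [z m]. *)
  exfalso.
  have Dm : D m by apply: contraT => /(walk_neq w); rewrite zm eqxx.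
  have mk : (m <= k)%N := leq_subr _ _.
  case: (m) Dm zm hf mk f => [|n] Dm zm hf nk f.
    exact: (negP D0).
  have Dn : ~~ D n.
    by apply/negP => Dn; move: Dm; apply/negP/(D_sparse Dn); lia.
  have : z n <= z n.+1 by apply: mono; exact: ltnW.
  rewrite le_eqVlt (negbTE (walk_neq w Dn)) /= => up.
  have hu := walk_up w n; rewrite -zm in f hf.
  have [_] := adjacentL (walk_bdry w _) (walk_bdry w _) up f hu hf.
  by rewrite /=; case: odd.
have f := fall _ (leqnn k); have h := walk_down w (k + k).+1.
have := retrace _ (leqnn k); rewrite subnn => zz; rewrite zz in f h.
exact: (walk_anchor w f h).
Qed.

Lemma walk_mono z : walk D z -> forall k, z k <= z k.+1.
Proof.
move=> w k; elim/ltn_ind: k => -[|k] IH; first exact: ltW (walk_right w).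
rewrite leNgt; apply/negP; apply: (walk_no_fold w) => j jk.
by apply: IH; rewrite ltnS.
Qed.
End Monotone.

(** If only [z] stalls at [k], sparsity makes it rise along gap [k+1] while [z'] rises along gap [k]
    from the same point: opposite values just right of it. *)
Lemma walk_collapse (D D' : pred nat) z z' k :
  sparse D -> sparse D' -> ~~ D 0 -> ~~ D' 0 ->
  walk D z -> walk D' z' -> z k = z' k -> z k.+1 = z k ->
  z' k.+1 = z' k.
Proof.
move=> sD sD' D0 D'0 w w' zz' zk; apply/eqP.
have := walk_mono sD' D'0 w' k; rewrite le_eqVlt eq_sym => /orP[//|up].
exfalso.
have Dk : D k by apply: contraT => /(walk_neq w); rewrite zk eqxx.
have Dk1 : ~~ D k.+1 by apply: (sD k) => //; lia.
have := walk_mono sD D0 w k.+1.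
rewrite le_eqVlt (negbTE (walk_neq w Dk1)) /= => up1.
have h := walk_up w k.+1; rewrite zk zz' in up1 h.
have [_] := adjacentR (walk_bdry w _) (walk_bdry w' _) up1 up h
  (walk_up w' _).
by rewrite /=; case: odd.
Qed.

Lemma walk_unique (D D' : pred nat) z z' :
  sparse D -> sparse D' -> ~~ D 0 -> ~~ D' 0 ->
  walk D z -> walk D' z' -> z 0 = z' 0 -> z =1 z'.
Proof.
move=> sD sD' D0 D'0 w w' z0; elim=> // k IH.
have := walk_mono sD D0 w k; have := walk_mono sD' D'0 w' k.
rewrite !le_eqVlt => /orP[/eqP e'|up'].
  by rewrite -e' -IH (walk_collapse sD' sD D'0 D0 w' w).
move=> /orP[/eqP e|up].
  by rewrite -e IH (walk_collapse sD sD' D0 D'0 w w').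
have h := walk_up w k; rewrite IH in up h.
by have [] := adjacentR (walk_bdry w _) (walk_bdry w' _) up up' h
  (walk_up w' _).
Qed.
End Walk.

(** * Boundary points under preimages and a criterion for [D2] *)

Section Boundary.
Context (R : realType).
Implicit Types (A B : set R) (x : R).

Lemma bdry_sides A c c' l x r : l < x < r -> c <> c' ->
  const_on A c l x -> const_on A c' x r -> bdry A x.
Proof.
move=> /andP[lx xr] cc' h h' l' r' d /andP[lx' xr'] hd; apply: cc'.
have lm : Num.max l l' < x by rewrite gt_max lx.
have mr : x < Num.min r r' by rewrite lt_min xr.
have -> : c = d.
  by apply: (const_on_inj lm); [apply: const_on_sub h | apply: const_on_sub hd];
    rewrite ?le_max ?lexx ?orbT ?(ltW xr').
by apply: (const_on_inj mr); [apply: const_on_sub hd | apply: const_on_sub h'];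
  rewrite ?ge_min ?lexx ?orbT ?(ltW lx').
Qed.

Lemma bdry_right A (c : bool) x r :
  x < r -> ~ (A x <-> c) -> const_on A c x r -> bdry A x.
Proof.
move=> xr Axc h l' r' d /andP[lx' xr'] hd; apply: Axc.
have mr : x < Num.min r r' by rewrite lt_min xr.
have -> : c = d.
  by apply: (const_on_inj mr); [apply: const_on_sub h | apply: const_on_sub hd];
    rewrite ?ge_min ?lexx ?orbT ?(ltW lx').
by apply: hd; rewrite lx'.
Qed.

Lemma bdry_image (f : R -> R) B x : continuous f ->
  bdry (f @^-1` B) x -> bdry B (f x).
Proof.
move=> cf bx l r c lr h.
have /cf/nbhs_ballP[e /= e0 be] : nbhs (f x) `]l, r[%classic.
  by apply: near_in_itvoo; rewrite in_itv.
apply: (bx (x - e) (x + e) c); first by lra.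
move=> u xu; apply: h.
have := be u; rewrite /ball /= in_itv /=; apply.
by rewrite ltr_norml; lra.
Qed.

(** On each side of [x], a short open interval lies in [A] or misses [A], hence misses [closure A].
    So [A] is open in its closure. *)
Lemma D2_one_sided A :
  (forall x, A x -> exists l r c c',
    [/\ l < x < r, const_on A c l x & const_on A c' x r]) ->
  D2 A.
Proof.
move=> loc; exists ((A `|` ~` closure A)°), (closure A).
split; [exact: open_interior | exact: closed_closure |].
apply/seteqP; split=> [x Ax|x [/interior_subset[]//]].
split; last exact: subset_closure.
have [l [r [c [c' [lxr h h']]]]] := loc _ Ax.
have local_in d l' r' u : const_on A d l' r' -> l' < u < r' ->
    (A `|` ~` closure A) u.
  move=> hd lur; case: d hd => hd; [by left; apply/hd | right => cu].
  have [|v [Av /=]] := cu `]l', r'[%classic.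
    by apply: near_in_itvoo; rewrite in_itv.
  by rewrite in_itv /= => /hd[/(_ Av)].
have xlr : nbhs x `]l, r[%classic by apply: near_in_itvoo; rewrite in_itv.
apply: filterS xlr => u /=; rewrite in_itv /= => /andP[lu ur].
case: (ltgtP u x) => [ux|xu|->]; last by left.
- by apply: (local_in _ _ _ _ h); rewrite lu.
- by apply: (local_in _ _ _ _ h'); rewrite xu.
Qed.
End Boundary.

(** * The comb set coded by [D] *)

Fixpoint endpoint_in (D : pred nat) (k : nat) : bool :=
  if k is j.+1 then endpoint_in D j (+) ~~ D j else false.

Section Comb.
Context (R : realType) (D : pred nat).

Definition comb : set R := [set x |
  [\/ exists n, x = - n.+1%:R^-1,
      exists2 k, k%:R < x < k.+1%:R & ~~ odd k |
      exists2 k, x = k%:R & endpoint_in D k]].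

Lemma comb_gap k : const_on comb (~~ odd k) k%:R k.+1%:R.
Proof.
move=> x /andP[kx xk]; have x0 : 0 < x by apply: le_lt_trans kx.
split=> [[[n xn]|[j /andP[jx xj] oj]|[j xj _]]|ok].
- by move: x0; rewrite xn oppr_gt0 ltNge invr_ge0 ler0n.
- have := lt_trans kx xj; have := lt_trans jx xk; rewrite !ltr_nat !ltnS.
  by move=> jk kj; have -> : k = j by apply/eqP; rewrite eqn_leq kj.
- by move: kx xk; rewrite xj !ltr_nat; lia.
- by constructor 2; exists k => //; rewrite kx.
Qed.

Arguments comb_gap k [u] _ : rename.

Lemma comb_nat k : comb k%:R <-> endpoint_in D k.
Proof.
split=> [[[n /eqP]|[j /andP[]]|[j /eqP]]|tk]; last by constructor 3; exists k.
- by rewrite -subr_eq0 opprK paddr_eq0 // invr_eq0 !pnatr_eq0 andbF.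
- by rewrite !ltr_nat; lia.
- by rewrite eqr_nat => /eqP ->.
Qed.

(** Real [s] and [s'] are allowed because the isolated point [-1] has no neighbour [- n^-1] on its
    left to bound an interval. *)
Lemma comb_neg n (s s' : R) : 0 < s -> 0 < s' ->
  n%:R <= s -> s' <= n.+1%:R -> const_on comb false (- s^-1) (- s'^-1).
Proof.
move=> s0 s'0 ns s'n x /andP[sx xs]; split=> //.
have x0 : x < 0 by apply: lt_trans xs _; rewrite oppr_lt0 invr_gt0.
move=> [[m xm]|[j /andP[jx _] _]|[j xj _]].
- move: sx xs; rewrite xm !ltrN2 !ltf_pV2 ?posrE ?ltr0n //.
  move=> /(le_lt_trans ns) + /lt_le_trans /(_ s'n).
  by rewrite !ltr_nat; lia.
- by move: (lt_trans jx x0); rewrite ltrn0.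
- by move: x0; rewrite xj ltrn0.
Qed.

Lemma bdry_comb_nat k : bdry comb k%:R.
Proof.
case: k => [|k]; last first.
  apply: (bdry_sides (c := ~~ odd k) (c' := ~~ odd k.+1) _ _
    (comb_gap k) (comb_gap k.+1)).
    by rewrite !ltr_nat !ltnSn.
  by rewrite /=; case: odd.
apply: (bdry_right _ _ (comb_gap 0)); rewrite ?ltr_nat //.
by rewrite comb_nat => -[_ /(_ isT)].
Qed.

Lemma bdry_comb_neg n : bdry comb (- n.+1%:R^-1).
Proof.
apply: (@bdry_right _ _ false _ (- n.+2%:R^-1)).
- by rewrite ltrN2 ltf_pV2 ?posrE ?ltr0n // ltr_nat.
- by case=> h _; have /h : comb (- n.+1%:R^-1) by constructor 1; exists n.
- by apply: (@comb_neg n.+1).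
Qed.

Lemma comb_D2 : D2 comb.
Proof.
apply: D2_one_sided => x [[n ->]|[k kx ok]|[k -> tk]].
- exists (- (n%:R + 2^-1)^-1), (- n.+2%:R^-1), false, false.
  have n0 : 0 <= n%:R :> R by [].
  split; [|apply: (@comb_neg n)|apply: (@comb_neg n.+1)] => //.
  + by rewrite !ltrN2 !ltf_pV2 ?posrE ?ltr0n ?ltr_nat ?ltnSn ?andbT //
       -?[n.+1%:R]natr1; lra.
  + lra.
- exists k%:R, k.+1%:R, true, true; have /andP[kx1 kx2] := kx.
  have := comb_gap k; rewrite ok => h.
  by split; rewrite ?kx //; apply: const_on_sub h; rewrite ?lexx // ltW.
- case: k tk => // k _.
  exists k%:R, k.+2%:R, (~~ odd k), (~~ odd k.+1).
  split; [by rewrite !ltr_nat !ltnSn | exact: (comb_gap k) |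
    exact: (comb_gap k.+1)].
Qed.

Lemma comb_walk (f : R -> R) B : continuous f -> comb = f @^-1` B ->
  f 0 < f 1 -> walk B D (fun k => f k%:R).
Proof.
move=> cf fB f01.
have gap k u : (f k%:R < u < f k.+1%:R) || (f k.+1%:R < u < f k%:R) ->
    (B u <-> ~~ odd k).
  move=> hu; have [uk uk1] : u <> f k%:R /\ u <> f k.+1%:R.
    by split=> e; move: hu; rewrite e !ltxx ?andbF.
  have [||s + fs] := @IVT R f k%:R k.+1%:R u _ (continuous_subspaceT cf).
  - by rewrite ler_nat.
  - by case/orP: hu => /andP[h h']; rewrite ge_min le_max (ltW h) (ltW h')
       ?orbT.
  rewrite in_itv /= => /andP[ks sk]; rewrite -(comb_gap k (u := s)).
    by rewrite fB /= fs.
  by rewrite !lt_neqAle ks sk !andbT; apply/andP; split; apply/eqP => e;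
    [apply: uk|apply: uk1]; rewrite -fs -e.
have up k : const_on B (~~ odd k) (f k%:R) (f k.+1%:R).
  by move=> u h; apply: gap; rewrite h.
split=> //.
- by move=> k; apply: bdry_image => //; rewrite -fB; apply: bdry_comb_nat.
- by move=> k u h; apply: gap; rewrite h orbT.
- move=> k Dk; apply/eqP => e.
  have : comb k%:R <-> comb k.+1%:R by rewrite fB /= e.
  rewrite !comb_nat /= Dk addbT; case: endpoint_in => -[] //;
    first by move/(_ isT).
  by move=> _ /(_ isT).
(* An isolated point [x] close to 0 has its image in []l, f 1[]. This image is a boundary point, so
   it avoids both intervals of constancy, and it is not [f 0] because [x] is in the comb and 0 is
   not. *)
move=> l c l0 h; have h1 := up 0%N.
have /cf/nbhs_ballP[e /= e0 be] : nbhs (f 0) `]l, f 1[%classic.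
  by apply: near_in_itvoo; rewrite in_itv /= l0.
have [n ne] := ltr_add_invr e0; rewrite add0r in ne.
set x : R := - n.+1%:R^-1.
have bx : bdry B (f x).
  by apply: bdry_image => //; rewrite -fB; apply: bdry_comb_neg.
have /be /= : ball 0 e x.
  by rewrite /ball /= sub0r opprK ger0_norm // invr_ge0.
rewrite in_itv /= => /andP[lx xr].
case: (ltgtP (f x) (f 0)) => xx.
- by apply: (bx l (f 0) c) => //; rewrite lx.
- by apply: (bx (f 0) (f 1) true) => //; rewrite xx.
have : comb x by constructor 1; exists n.
by rewrite fB /= xx -[B _]/((f @^-1` B) 0%:R) -fB comb_nat.
Qed.
End Comb.
Arguments comb R D _ : clear implicits.

(** * Sparse codes and the countability of their reductions *)

Definition pow4_code (a : set nat) : pred nat :=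
  fun k => `[< exists2 i, a i & k = (4 ^ i)%N >].

(** [4 * 4^i > 2 * 4^i + 1]. Base 3 would fail at [i = 0], where the next power equals
    [2 * 1 + 1]. *)
Lemma pow4_code_sparse a : sparse (pow4_code a).
Proof.
move=> k j /asboolP[i _ ->] /andP[ij ji]; apply/asboolP => -[m _ jE].
move: ij ji; rewrite jE ltn_exp2l // => im.
have : (4 ^ i.+1 <= 4 ^ m)%N by rewrite leq_exp2l.
have : (0 < 4 ^ i)%N by rewrite expn_gt0.
by rewrite expnS; lia.
Qed.

Lemma pow4_code0 a : ~~ pow4_code a 0.
Proof. by apply/asboolP => -[i _] /esym/eqP; rewrite expn_eq0. Qed.

Lemma pow4_codeE a i : pow4_code a (4 ^ i)%N <-> a i.
Proof.
split=> [/asboolP[j aj /eqP]|ai]; last by apply/asboolP; exists i.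
by rewrite eqn_exp2l // => /eqP ->.
Qed.

Definition comb_code (R : realType) (a : set nat) : set R :=
  comb R (pow4_code a).

Arguments comb_code R a _ : clear implicits.

Lemma comb_code_inj (R : realType) (a b : set nat) (f g : R -> R) B (q : R) :
  continuous f -> continuous g ->
  comb_code R a = f @^-1` B -> comb_code R b = g @^-1` B ->
  f 0 < q < f 1 -> g 0 < q < g 1 -> a = b.
Proof.
move=> cf cg fB gB /andP[f0 f1] /andP[g0 g1].
have wf := comb_walk cf fB (lt_trans f0 f1).
have wg := comb_walk cg gB (lt_trans g0 g1).
have notin (h : R -> R) c : comb_code R c = h @^-1` B -> ~ B (h 0%:R).
  by move=> hB; rewrite -[B _]/((h @^-1` B) _) -hB /comb_code comb_nat.
(* The larger of the two starting points would lie strictly inside the other walk's first gap, hence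
   in [B]. *)
have start : f 0%:R = g 0%:R.
  case: (ltgtP (f 0%:R) (g 0%:R)) => // h; exfalso.
    apply: (notin _ _ gB); apply/(walk_up wf (k := 0%N)) => //=.
    by rewrite h (lt_trans g0).
  apply: (notin _ _ fB); apply/(walk_up wg (k := 0%N)) => //=.
  by rewrite h (lt_trans f0).
have fg : forall k, f k%:R = g k%:R.
  by apply: (walk_unique _ _ _ _ wf wg start);
    [exact: pow4_code_sparse..|exact: pow4_code0|exact: pow4_code0].
have ends k : endpoint_in (pow4_code a) k = endpoint_in (pow4_code b) k.
  by apply/idP/idP; rewrite -!(@comb_nat R);
    rewrite -!/(comb_code R _) fB gB /= fg.
apply/funext => i; apply/propext.
rewrite -!pow4_codeE; have := ends (4 ^ i)%N.+1; rewrite /= ends.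
by move/addbI/negb_inj => ->.
Qed.

Lemma comb_code_countable (R : realType) (B : set R) :
  countable [set a | reducible (comb_code R a) B].
Proof.
(* The sign reflects [B] so that the walk starts rightwards; the rational marks its first gap. Each
   [S p] then has at most one element. *)
pose S (p : rat * bool) := [set a | exists f : R -> R,
  [/\ continuous f, comb_code R a = f @^-1` [set x | B ((-1) ^+ p.2 * x)]
    & f 0 < ratr p.1 < f 1]].
apply: (@sub_countable _ _ _ (\bigcup_(p in setT) S p)); last first.
  apply: bigcup_countable => // p _; apply/countable_injP; exists (fun=> 0%N).
  move=> a b; rewrite !inE => -[f [cf fB fq]] [g [cg gB gq]] _.
  exact: comb_code_inj cf cg fB gB fq gq.
apply: subset_card_le => a [f [cf fB]].
(* Gap 0 is never in the code, so exactly one of 0 and 1 is in the comb. *)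
have f01 : f 0 != f 1.
  apply/eqP => e; have : comb_code R a 0%:R <-> comb_code R a 1%:R.
    by rewrite fB /= e.
  rewrite /comb_code !comb_nat /= (negbTE (pow4_code0 a)) /=.
  by case=> _ /(_ isT).
have [s lts] : exists s : bool, (-1) ^+ s * f 0 < (-1) ^+ s * f 1.
  case: ltgtP f01 => // h _; [exists false | exists true];
  by rewrite ?expr0 ?expr1 ?mul1r // !mulN1r ltrN2.
have [q] := rat_in_itvoo lts; rewrite in_itv /= => hq.
exists (q, s) => //; exists (fun x => (-1) ^+ s * f x); split=> //.
  by move=> x; apply: cvgM; [exact: cvg_cst | exact: cf].
by rewrite fB; apply/seteqP; split=> x /=; rewrite signrMK.
Qed.

Lemma set_nat_uncountable : ~ countable [set: set nat].
Proof.
move=> /countable_injP[f inj].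
pose D : set nat := [set n | exists2 a, f a = n & ~ a n].
suff: D (f D) <-> ~ D (f D) by tauto.
split=> [[a fa na] Da|nD]; last by exists D.
by apply: na; rewrite (inj a D) ?inE.
Qed.

(** * Borel levels from 2 upward *)

Section Levels.
Context (R : realType) d (W : orderType d).
Implicit Types (x : W) (A : set R).

(** A minimal element having a predecessor has just one, since its predecessors have none and the
    order is total. *)
Lemma exists_ord_one x : well_founded (fun y z : W => (y < z)%O) ->
  ord_ge2 x -> exists2 m : W, ord_one m & (m < x)%O.
Proof.
move=> wf [y [z [yz zx]]].
have [m [[v vm] mz] mmin] : exists2 m : W, (exists v, (v < m)%O) /\ (m <= z)%O &
    forall v, (v < m)%O -> forall u, ~ (u < v)%O.
  have : exists v, (v < z)%O by exists y.
  elim/(well_founded_ind wf): z {yz zx} => z IH hz.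
  have [[v vz [u uv]]|no] := pselect
    (exists2 v, (v < z)%O & exists u, (u < v)%O).
    have [m [h mv] mmin] := IH v vz (ex_intro _ u uv).
    by exists m => //; split=> //; rewrite (le_trans mv) ?ltW.
  exists z => // v vz u uv; apply: no; exists v => //; by exists u.
exists m; last exact: le_lt_trans zx.
exists v; apply/seteqP; split=> [u /= uo|u ->//].
by case: (ltgtP u v) => // h; case: (mmin _ _ _ h).
Qed.

Definition Fsigma A :=
  exists2 F : nat -> set R, (forall n, closed (F n)) & A = \bigcup_n F n.

Lemma Fsigma_Sigma0 x A : well_founded (fun y z : W => (y < z)%O) ->
  ord_ge2 x -> Fsigma A -> Sigma0 x A.
Proof.
move=> wf x2 [F cF ->]; have [y y1 yx] := exists_ord_one wf x2.
apply: (Sigma0_bigcup (y := fun=> y)) => // n.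
by apply: Sigma0_open => //; exact: closed_openC.
Qed.
End Levels.

(** The closed pieces consist of the points at distance at least [1/(n+1)] from the complement. *)
Lemma open_Fsigma (R : realType) (U : set R) : open U -> Fsigma U.
Proof.
move=> oU; pose G n : set R := \bigcup_(x in ~` U) ball x n.+1%:R^-1.
exists (fun n => ~` G n).
  move=> n; apply: open_closedC; apply: bigcup_open => x _; exact: ball_open.
apply/seteqP; split=> x /=; last first.
  by move=> [n _ nG]; apply: contrapT => nU; apply: nG;
    exists x => //; exact: ballxx.
move=> Ux; have /nbhs_ballP[e /= e0 be] : nbhs x U by exact: open_nbhs_nbhs.
have [n ne] := ltr_add_invr e0; rewrite add0r in ne.
exists n => // -[y nUy /ball_sym yx]; apply: nUy; apply: be.
exact: (le_ball (ltW ne)) yx.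
Qed.

Lemma D2_Fsigma (R : realType) (A : set R) : D2 A -> Fsigma A /\ Fsigma (~` A).
Proof.
move=> [U [F [oU cF ->]]]; have [G cG UE] := open_Fsigma oU.
have [H cH FE] := open_Fsigma (closed_openC cF); split.
  exists (fun n => G n `&` F); first by move=> n; exact: closedI.
  by rewrite UE setI_bigcupl.
exists (fun n => if n is m.+1 then H m else ~` U).
  by case=> // ; exact: open_closedC.
rewrite setCI FE; apply/seteqP; split=> x.
  by case=> [Ux|[n _ Hx]]; [exists 0%N | exists n.+1].
by case=> -[|n] _ h; [left | right; exists n].
Qed.

Theorem theorem4p1 (R : realType) :
  [/\ forall (d : Order.disp_t) (W : orderType d) (alpha : W),
        countable_ordinal alpha -> ord_ge2 alpha ->
        ~ (exists A : set R, complete_for (Sigma0 alpha) A) /\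
        ~ (exists A : set R, complete_for (Pi0 alpha) A),
      exists B_ : set nat -> set R,
        (forall a, D2 (B_ a)) /\
        (forall B : set R, countable [set a | reducible (B_ a) B])
    & exists B'_ : set nat -> set R,
        (forall a, dual_D2 (B'_ a)) /\
        (forall B : set R, countable [set a | reducible (B'_ a) B])].
Proof.
have D2comb a : D2 (comb_code R a) by exact: comb_D2.
have not_hard A : ~ forall a, reducible (comb_code R a) A.
  move=> h; apply: set_nat_uncountable.
  apply: sub_countable (comb_code_countable A).
  by apply: subset_card_le => a _; exact: h.
split.
- move=> d W alpha [wf _] ge2.
  split=> -[A [_ Acomp]]; apply: (not_hard A) => a; apply: Acomp;
    by apply: Fsigma_Sigma0 => //; have [] := D2_Fsigma (D2comb a).
- by exists (comb_code R); split=> // B; exact: comb_code_countable.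
- exists (fun a => ~` comb_code R a); split=> [a|B].
    by rewrite /dual_D2 setCK.
  (* The same [f] reduces the complements. *)
  apply: sub_countable (comb_code_countable (~` B)).
  apply: subset_card_le => a [f [cf fB]]; exists f; split=> //.
  by rewrite -preimage_setC -fB setCK.
Qed.
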